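(* The calculus of the probabilistic propositional logic $\mathsf{PPL}$ is (strongly) sound: for every $\Gamma\subseteq L_{\mathsf{PPL}}$ and $\varphi\in L_{\mathsf{PPL}}$, if $\Gamma\vdash\varphi$ then $\Gamma\vDash\varphi$.
   Context: **Classical part.** $B=\{B_j: j\in\mathbb N\}$ is a denumerable set of propositional symbols; $L$ is the set of propositional formulas generated from $B$ by $\neg,\supset$ (other connectives, verum $\mathsf{tt}$ and falsum $\mathsf{ff}$ are abbreviations, e.g. $\mathsf{tt}$ is $B_1\vee\neg B_1$). A valuation $v:B\to\{0,1\}$ is identified with $\{B_j: v(B_j)=1\}$; $\Vdash_c,\vDash_c$ are classical satisfaction and entailment. $B_\alpha$ is the set of symbols occurring in $\alpha$; $[\![\alpha]\!]=\{v\cap B_\alpha: v\Vdash_c\alpha\}$. For finite $A\subseteq B$ and $U\subseteq A$, $\phi_A^U$ is $\big(\bigwedge_{B_j\in U}B_j\big)\wedge\big(\bigwedge_{B_j\in A\setminus U}\neg B_j\big)$. **Stochastic valuations.** A stochastic valuation $V$ is a family $\{V_{B_j}\}_{B_j\in B}$ of random variables on a probability space $(\Omega,\mathcal F,\mu)$, $V_{B_j}$ taking values in $\{\emptyset,\{B_j\}\}$ (false/true). For finite non-empty $A\subseteq B$, $U\subseteq A$: $\mathrm{Prob}(V_A=U)=\mu\big(\bigcap_{B_j\in A}V_{B_j}^{-1}(U\cap\{B_j\})\big)$. $\mathrm{Prob}_V(\alpha)=\sum_{U\in[\![\alpha]\!]}\mathrm{Prob}(V_{B_\alpha}=U)$.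 **RCOF.** $\mathsf{RCOF}$ is the first-order theory of real closed ordered fields over $0,1,-,+,\times,=,<$ (its theorems are exactly the sentences true in $\mathbb R$), with variables $X=\{x_k:k\in\mathbb N\}\cup\{x_\alpha:\alpha\in L\}$. $T_{\mathsf{RCOF}}$ is the set of its terms using no variable $x_\alpha$ with $\alpha\in L$; numerals $m$ and fractions $n/m$ are used as abbreviations. $t^{\mathbb R\rho}$ is the value of term $t$ in $\mathbb R$ under assignment $\rho:X\to\mathbb R$. **Language.** $L_{\mathsf{PPL}}$ is generated by: $\int\alpha\mathbin{@}p\in L_{\mathsf{PPL}}$ for $\alpha\in L$, $p\in T_{\mathsf{RCOF}}$, $@\in\{=,<\}$; and $\varphi_1\supset\varphi_2\in L_{\mathsf{PPL}}$ for $\varphi_1,\varphi_2\in L_{\mathsf{PPL}}$. Abbreviations: $\neg\varphi$ is $\varphi\supset(\int\mathsf{tt}<1)$; $\wedge,\vee,\equiv$ are defined from $\neg,\supset$ as usual; $\int\alpha\le p$ is $(\int\alpha=p)\vee(\int\alpha<p)$; $\int\alpha\ge p$ is $\neg(\int\alpha<p)$. **Semantics.** $V\rho\Vdash\int\alpha\mathbin{@}p$ iff $\mathrm{Prob}_V(\alpha)\mathbin{@}p^{\mathbb R\rho}$; $V\rho\Vdash\varphi_1\supset\varphi_2$ iff $V\rho\not\Vdash\varphi_1$ or $V\rho\Vdash\varphi_2$. $\Gamma\vDash\varphi$ iff for all $V$ and $\rho:X\to\mathbb R$, if $V\rho\Vdash\gamma$ for all $\gamma\in\Gamma$ then $V\rho\Vdash\varphi$.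 **Adequate sets.** $\Lambda=\{\alpha_{11},\dots,\alpha_{1m_1},\dots,\alpha_{k1},\dots,\alpha_{km_k}\}\subset L$ is an adequate set of DNF-conjuncts for $\{\alpha_1,\dots,\alpha_k\}\subset L$ if: (1) the set of symbols of every $\alpha_{j\ell}$ is $B_\Lambda:=B_{\alpha_1}\cup\dots\cup B_{\alpha_k}$; (2) each $\alpha_{j\ell}$ is a conjunction of literals; (3) $\vDash_c\neg(\alpha_{j\ell}\wedge\alpha_{j\ell'})$ for $1\le\ell\ne\ell'\le m_j$; (4) $\vDash_c\alpha_j\equiv\bigvee_{\ell=1}^{m_j}\alpha_{j\ell}$ for each $j$. Then $Q^{\alpha_1,\dots,\alpha_k}_{\alpha_{11},\dots,\alpha_{km_k}}$ is the $\mathsf{RCOF}$ formula $$\Big(\bigwedge_{U\subseteq B_\Lambda}0\le x_{\phi^U_{B_\Lambda}}\le1\Big)\wedge\Big(\sum_{U\subseteq B_\Lambda}x_{\phi^U_{B_\Lambda}}=1\Big)\wedge\bigwedge_{j=1}^k\Big(x_{\alpha_j}=\sum_{\ell=1}^{m_j}x_{\alpha_{j\ell}}\Big).$$ **Calculus.** Axioms: (TT) every tautological formula of $L_{\mathsf{PPL}}$, i.e. every formula obtained from a classical tautology over $\neg,\supset$ by uniformly replacing propositional symbols by $\mathsf{PPL}$ formulas, with $\neg\varphi$ read as the $\mathsf{PPL}$ formula $\varphi\supset(\int\mathsf{tt}<1)$. (RR) every formula $\big(\int\alpha_1@_1p_1\wedge\dots\wedge\int\alpha_k@_kp_k\big)\supset\int\alpha_{k+1}@_{k+1}p_{k+1}$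 ($k\ge0$; just the conclusion if $k=0$), where $\alpha_j\in L$, $p_j\in T_{\mathsf{RCOF}}$, $@_j\in\{=,<,\le,\ge\}$, such that for some adequate set $\{\alpha_{11},\dots,\alpha_{(k+1)m_{k+1}}\}$ of DNF-conjuncts for $\{\alpha_1,\dots,\alpha_{k+1}\}$ the universal closure of $\big(Q^{\alpha_1,\dots,\alpha_{k+1}}_{\alpha_{11},\dots,\alpha_{(k+1)m_{k+1}}}\wedge\bigwedge_{j=1}^k(x_{\alpha_j}@_jp_j)\big)\supset(x_{\alpha_{k+1}}@_{k+1}p_{k+1})$ is a theorem of $\mathsf{RCOF}$. Rule: (MP) from $\varphi_1$ and $\varphi_1\supset\varphi_2$ infer $\varphi_2$. $\Gamma\vdash\varphi$ means there is a finite derivation of $\varphi$ from members of $\Gamma$ and axioms using MP. *)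

(* Defs.v *)
From HB Require Import structures.
From mathcomp Require Import all_boot all_order all_algebra.
From mathcomp Require Import finmap.
From mathcomp Require Import all_classical all_reals all_analysis.

Set Implicit Arguments.
Unset Strict Implicit.
Unset Printing Implicit Defensive.

Import Order.TTheory GRing.Theory Num.Theory.

Local Open Scope ring_scope.

(* The propositional symbol B_j is represented by its index j. *)
Inductive form : Type :=
| FVar of nat
| FNot of form
| FImp of form & form.

Lemma form_eq_dec (a b : form) : {a = b} + {a <> b}.
Proof. by decide equality; exact: eq_comparable. Defined.

HB.instance Definition _ := hasDecEq.Build form (compareP form_eq_dec).

Definition FOr (a b : form) : form := FImp (FNot a) b.
Definition FAnd (a b : form) : form := FNot (FImp a (FNot b)).
Definition FIff (a b : form) : form := FAnd (FImp a b) (FImp b a).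
Definition FTrue : form := FOr (FVar 1) (FNot (FVar 1)).
Definition FFalse : form := FNot FTrue.

(* Non-empty conjunctions and disjunctions carry no extra verum or falsum, so
   that no foreign symbol is introduced. *)
Fixpoint FbigAnd (s : seq form) : form :=
  match s with
  | [::] => FTrue
  | [:: a] => a
  | a :: s' => FAnd a (FbigAnd s')
  end.

Fixpoint FbigOr (s : seq form) : form :=
  match s with
  | [::] => FFalse
  | [:: a] => a
  | a :: s' => FOr a (FbigOr s')
  end.

Fixpoint csat (v : nat -> bool) (a : form) : bool :=
  match a with
  | FVar j => v j
  | FNot b => ~~ csat v b
  | FImp b c => csat v b ==> csat v c
  end.

Definition tautology (a : form) : Prop := forall v, csat v a.

Fixpoint symbols (a : form) : {fset nat} :=
  match a with
  | FVar j => [fset j]%fset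
  | FNot b => symbols b
  | FImp b c => (symbols b `|` symbols c)%fset
  end.

Definition restrict (v : nat -> bool) (A : {fset nat}) : {fset nat} :=
  [fset j in A | v j]%fset.

Definition fmodels (a : form) : set {fset nat} :=
  [set U | exists2 v, csat v a & U = restrict v (symbols a)]%classic.

(* phi_A^U, with symbols listed by increasing index. When one of the two
   conjunctions is empty it is omitted, so that the symbols of phi_A^U are
   exactly those of A for non-empty A. *)
Definition phiAU (A U : {fset nat}) : form :=
  let pos := [seq FVar j | j <- sort leq (enum_fset U)] in
  let neg := [seq FNot (FVar j) | j <- sort leq (enum_fset (A `\` U)%fset)] in
  if nilp pos then FbigAnd neg
  else if nilp neg then FbigAnd pos
  else FAnd (FbigAnd pos) (FbigAnd neg).

Definition is_literal (a : form) : bool :=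
  match a with
  | FVar _ | FNot (FVar _) => true
  | _ => false
  end.

(* The bracketing of the conjunction is arbitrary. *)
Inductive is_conj_of_literals : form -> Prop :=
| ConjLit a : is_literal a -> is_conj_of_literals a
| ConjAnd a b : is_conj_of_literals a -> is_conj_of_literals b ->
    is_conj_of_literals (FAnd a b).

(* A random variable with values in {emptyset, {B_j}} is rendered as a boolean
   one: [false] stands for emptyset and [true] for {B_j}; hence the value
   U `&` {B_j} becomes [j \in U]. *)
Section StochasticValuation.
Context (R : realType) (d : measure_display) (T : measurableType d).
Context (P : probability T R) (V : nat -> {RV P >-> bool}).

Definition ProbVA (A U : {fset nat}) : R :=
  fine (P (\bigcap_(j in [set` A]) (V j @^-1` [set (j \in U)]))%classic).

Definition ProbV (a : form) : R :=
  \sum_(U \in fmodels a) ProbVA (symbols a) U.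

End StochasticValuation.

Inductive var : Type :=
| XNat of nat
| XForm of form.

Lemma var_eq_dec (x y : var) : {x = y} + {x <> y}.
Proof. by decide equality; exact: eq_comparable. Defined.

HB.instance Definition _ := hasDecEq.Build var (compareP var_eq_dec).

Inductive term : Type :=
| TVar of var
| TZero
| TOne
| TOpp of term
| TAdd of term & term
| TMul of term & term.

Definition TSum (s : seq term) : term := foldr TAdd TZero s.

Inductive rform : Type :=
| REq of term & term
| RLt of term & term
| RNot of rform
| RImp of rform & rform
| RAll of var & rform.

Definition ROr (f g : rform) : rform := RImp (RNot f) g.
Definition RAnd (f g : rform) : rform := RNot (RImp f (RNot g)).
Definition RLe (t u : term) : rform := ROr (REq t u) (RLt t u).
Definition RTrue : rform := REq TZero TZero.
Definition RbigAnd (s : seq rform) : rform := foldr RAnd RTrue s.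

Fixpoint term_vars (t : term) : seq var :=
  match t with
  | TVar x => [:: x]
  | TZero | TOne => [::]
  | TOpp u => term_vars u
  | TAdd u w | TMul u w => term_vars u ++ term_vars w
  end.

Fixpoint free_vars (f : rform) : seq var :=
  match f with
  | REq t u | RLt t u => term_vars t ++ term_vars u
  | RNot g => free_vars g
  | RImp g h => free_vars g ++ free_vars h
  | RAll x g => [seq y <- free_vars g | y != x]
  end.

Definition is_sentence (f : rform) : bool := nilp (free_vars f).

Definition universal_closure (f : rform) : rform :=
  foldr RAll f (undup (free_vars f)).

Definition is_form_var (x : var) : bool :=
  if x is XForm _ then true else false.

Definition T_RCOF : Type := {t : term | ~~ has is_form_var (term_vars t)}.

Definition T_one : T_RCOF := exist _ TOne isT.

Section RealSemantics.
Context (R : realType).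

Fixpoint eval (rho : var -> R) (t : term) : R :=
  match t with
  | TVar x => rho x
  | TZero => 0
  | TOne => 1
  | TOpp u => - eval rho u
  | TAdd u w => eval rho u + eval rho w
  | TMul u w => eval rho u * eval rho w
  end.

Definition update (rho : var -> R) (x : var) (r : R) : var -> R :=
  fun y => if y == x then r else rho y.

Fixpoint rsat (rho : var -> R) (f : rform) : Prop :=
  match f with
  | REq t u => eval rho t = eval rho u
  | RLt t u => eval rho t < eval rho u
  | RNot g => ~ rsat rho g
  | RImp g h => rsat rho g -> rsat rho h
  | RAll x g => forall r : R, rsat (update rho x r) g
  end.

(* The theorems of RCOF are the sentences that are true in the reals. *)
Definition RCOF_theorem (f : rform) : Prop :=
  is_sentence f /\ forall rho : var -> R, rsat rho f.

End RealSemantics.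

Inductive cmp : Type := CEq | CLt.

Inductive ppl : Type :=
| PInt of form & cmp & T_RCOF
| PImp of ppl & ppl.

Definition PNot (f : ppl) : ppl := PImp f (PInt FTrue CLt T_one).
Definition POr (f g : ppl) : ppl := PImp (PNot f) g.
Definition PAnd (f g : ppl) : ppl := PNot (PImp f (PNot g)).

Fixpoint psat (R : realType) (d : measure_display) (T : measurableType d)
    (P : probability T R) (V : nat -> {RV P >-> bool}) (rho : var -> R)
    (f : ppl) : Prop :=
  match f with
  | PInt a CEq p => ProbV V a = eval rho (sval p)
  | PInt a CLt p => ProbV V a < eval rho (sval p)
  | PImp g h => ~ psat V rho g \/ psat V rho h
  end.

Definition entails (R : realType) (Gamma : set ppl) (phi : ppl) : Prop :=
  forall (d : measure_display) (T : measurableType d) (P : probability T R)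
    (V : nat -> {RV P >-> bool}) (rho : var -> R),
    (forall gamma, Gamma gamma -> psat V rho gamma) -> psat V rho phi.

Definition symbolsU (al : seq form) : {fset nat} :=
  (\bigcup_(a <- al) symbols a)%fset.

(* [Lam] lists, for each alpha_j of [al], the conjuncts alpha_j1, ...,
   alpha_jm_j; here m_j = 0 is allowed, the empty disjunction being falsum. *)
Definition adequate (al : seq form) (Lam : seq (seq form)) : Prop :=
  [/\ size Lam = size al,
      forall c, c \in flatten Lam -> symbols c = symbolsU al,
      forall c, c \in flatten Lam -> is_conj_of_literals c,
      forall j l l', (j < size al)%N ->
        (l < size (nth [::] Lam j))%N -> (l' < size (nth [::] Lam j))%N ->
        l <> l' ->
        tautology (FNot (FAnd (nth FTrue (nth [::] Lam j) l)
                              (nth FTrue (nth [::] Lam j) l')))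
    & forall j, (j < size al)%N ->
        tautology (FIff (nth FTrue al j) (FbigOr (nth [::] Lam j)))].

Definition xv (a : form) : term := TVar (XForm a).

Definition Qformula (al : seq form) (Lam : seq (seq form)) : rform :=
  let A := symbolsU al in
  let xs := [seq xv (phiAU A U) | U <- enum_fset (fpowerset A)] in
  RAnd (RbigAnd [seq RAnd (RLe TZero x) (RLe x TOne) | x <- xs])
    (RAnd (REq (TSum xs) TOne)
       (RbigAnd [seq REq (xv ac.1) (TSum [seq xv c | c <- ac.2])
                | ac <- zip al Lam])).

Inductive cmp4 : Type := QEq | QLt | QLe | QGe.

Definition patom (a : form) (q : cmp4) (p : T_RCOF) : ppl :=
  match q with
  | QEq => PInt a CEq p
  | QLt => PInt a CLt p
  | QLe => POr (PInt a CEq p) (PInt a CLt p)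
  | QGe => PNot (PInt a CLt p)
  end.

Definition ratom (x : term) (q : cmp4) (p : T_RCOF) : rform :=
  match q with
  | QEq => REq x (sval p)
  | QLt => RLt x (sval p)
  | QLe => RLe x (sval p)
  | QGe => RLe (sval p) x
  end.

Fixpoint PbigAnd (f : ppl) (s : seq ppl) : ppl :=
  if s is g :: s' then PAnd f (PbigAnd g s') else f.

Definition constraint : Type := (form * cmp4 * T_RCOF)%type.

Definition cform (c : constraint) : form := c.1.1.
Definition cppl (c : constraint) : ppl := patom c.1.1 c.1.2 c.2.
Definition crcof (c : constraint) : rform := ratom (xv c.1.1) c.1.2 c.2.

Definition RR_formula (prem : seq constraint) (concl : constraint) : ppl :=
  match prem with
  | [::] => cppl concl
  | c :: s => PImp (PbigAnd (cppl c) [seq cppl c' | c' <- s]) (cppl concl)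
  end.

Definition RR_axiom (R : realType) (f : ppl) : Prop :=
  exists (prem : seq constraint) (concl : constraint) (Lam : seq (seq form)),
    let al := [seq cform c | c <- rcons prem concl] in
    [/\ f = RR_formula prem concl,
        adequate al Lam
      & RCOF_theorem R (universal_closure
          (RImp (RAnd (Qformula al Lam) (RbigAnd [seq crcof c | c <- prem]))
                (crcof concl)))].

Fixpoint ppl_instance (s : nat -> ppl) (a : form) : ppl :=
  match a with
  | FVar j => s j
  | FNot b => PNot (ppl_instance s b)
  | FImp b c => PImp (ppl_instance s b) (ppl_instance s c)
  end.

Definition TT_axiom (f : ppl) : Prop :=
  exists (a : form) (s : nat -> ppl), tautology a /\ f = ppl_instance s a.

Inductive derives (R : realType) (Gamma : set ppl) : ppl -> Prop :=
| D_hyp f : Gamma f -> derives R Gamma f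
| D_TT f : TT_axiom f -> derives R Gamma f
| D_RR f : RR_axiom R f -> derives R Gamma f
| D_MP f g : derives R Gamma f -> derives R Gamma (PImp f g) ->
    derives R Gamma g.

(* Main.v *)
(** A stochastic valuation [V] determines for each classical formula [a] the
    event [ev V a] that the valuation drawn at random satisfies [a], and
    [ProbV V a] is its probability.  Given [rho], reinterpret every variable
    x_a as [ProbV V a]: finite additivity turns the formula Q of an adequate set
    into a true statement, and T_RCOF terms keep their value, so the theorem
    of RCOF attached to an instance of RR specializes to that instance. *)
From Stdlib Require List.
From mathcomp Require Import all_boot all_order all_algebra.
From mathcomp Require Import finmap.
From mathcomp Require Import all_classical all_reals all_analysis.
(* Last, because MathComp also has a [form] and a [restrict]. *)
Require Import Defs.

Set Implicit Arguments.
Unset Strict Implicit.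
Unset Printing Implicit Defensive.

Import Order.TTheory GRing.Theory Num.Theory.

Local Open Scope ring_scope.

(** * Classical satisfaction, restrictions of valuations, and models *)

Lemma csat_FAnd v a b : csat v (FAnd a b) = csat v a && csat v b.
Proof. by rewrite /FAnd /=; case: (csat v a); case: (csat v b). Qed.

Lemma csat_FTrue v : csat v FTrue.
Proof. by rewrite /=; case: (v 1). Qed.

Lemma csat_FbigAnd v s : csat v (FbigAnd s) = all (csat v) s.
Proof.
elim: s => [|a [|b s] IHs]; first exact: csat_FTrue.
  by rewrite /= andbT.
by rewrite [FbigAnd _]/= csat_FAnd IHs.
Qed.

Lemma csat_FbigOr v s : csat v (FbigOr s) = has (csat v) s.
Proof.
elim: s => [|a [|b s] IHs]; first by rewrite /=; case: (v 1).
  by rewrite /= orbF.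
rewrite [FbigOr _]/= [LHS]/= IHs [has _ (a :: _)]/=.
by case: (csat v a).
Qed.

(** The positive literals force [U] into the restriction of [v] to [A], and the negative ones
    exclude the rest of [A]. *)
Lemma csat_phiAU v (A U : {fset nat}) : (U `<=` A)%fset ->
  csat v (phiAU A U) = (restrict v A == U).
Proof.
move=> UA.
set neg := [seq FNot (FVar j) | j <- sort leq (enum_fset (A `\` U)%fset)].
set pos := [seq FVar j | j <- sort leq (enum_fset U)].
(* An omitted empty conjunction would be true anyway, so all three branches of [phiAU] have the same
   truth value. *)
have -> : csat v (phiAU A U) = all (csat v) pos && all (csat v) neg.
  rewrite /phiAU -/pos -/neg; case: nilP => [->|_]; first by rewrite csat_FbigAnd.
  case: nilP => [->|_]; first by rewrite csat_FbigAnd andbT.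
  by rewrite csat_FAnd !csat_FbigAnd.
rewrite !all_map !all_sort; apply/andP/eqP => [[/allP posU /allP negU]|<-].
  apply/fsetP => j; rewrite !inE /=; apply/andP/idP => [[jA vj]|jU].
    apply/negPn/negP => jNU; have := negU j; rewrite !inE jNU jA => /(_ isT).
    by rewrite /= vj.
  by split; [exact: (fsubsetP UA)|exact: posU].
split; apply/allP => j; first by rewrite !inE /= => /andP[].
by rewrite !inE /= => /andP[/[swap] ->].
Qed.

Lemma restrict_eqP v (A U : {fset nat}) : (U `<=` A)%fset ->
  restrict v A = U <-> forall j, j \in A -> v j = (j \in U).
Proof.
move=> UA; split=> [<- j jA|vU]; first by rewrite !inE jA.
apply/fsetP => j; rewrite !inE /=; apply/andP/idP => [[jA]|jU].
  by rewrite vU.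
by have jA := fsubsetP UA _ jU; rewrite vU.
Qed.

Lemma restrict_sub v A : (restrict v A `<=` A)%fset.
Proof. by apply/fsubsetP => j; rewrite !inE => /andP[]. Qed.

Lemma eq_csat v w a : (forall j, j \in symbols a -> v j = w j) ->
  csat v a = csat w a.
Proof.
elim: a => [j|b IHb|b IHb c IHc] /= vw; first by apply: vw; rewrite inE.
  by rewrite IHb.
by rewrite IHb ?IHc // => j js; apply: vw; rewrite inE js ?orbT.
Qed.

(** Satisfaction depends only on the symbols that occur, so the model that witnesses membership may
    be replaced by [v]. *)
Lemma fmodels_restrict v a : fmodels a (restrict v (symbols a)) <-> csat v a.
Proof.
split=> [[w wa vw]|va]; last by exists v.
rewrite (@eq_csat v w) // => j ja; have /fsetP/(_ j) := vw.
by rewrite !inE ja.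
Qed.

Lemma finite_fmodels a : finite_set (fmodels a).
Proof.
apply: (@sub_finite_set _ _ [set` fpowerset (symbols a)]); last exact: finite_fset.
by move=> U [v _ ->] /=; rewrite fpowersetE restrict_sub.
Qed.

(** * Probabilities as measures of events *)

Section Events.
Context (R : realType) (d : measure_display) (T : measurableType d).
Context (P : probability T R) (V : nat -> {RV P >-> bool}).
Local Open Scope classical_set_scope.

Definition ev (a : form) : set T := [set w | csat (fun j => V j w) a].

Lemma measurable_ev a : measurable (ev a).
Proof.
elim: a => [j|b IHb|b IHb c IHc].
- have := @measurable_funPT _ _ _ _ (V j) measurableT [set true] I.
  rewrite setTI; congr (measurable _).
- have -> : ev (FNot b) = ~` ev b.
    by apply/seteqP; split=> w; rewrite /ev /= => /negP.
  exact: measurableC.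
- have -> : ev (FImp b c) = ~` ev b `|` ev c.
    apply/seteqP; split=> w; rewrite /ev /=.
      by case: (csat _ b) => /=; [right|left].
    by move=> [/negP/negbTE ->|->] //; rewrite implybT.
  by apply: measurableU => //; exact: measurableC.
Qed.

(** The values of the random valuation on the symbols of [a] cut [ev a] into finitely many disjoint
    cells, one per member of [fmodels a]; finite additivity sums them. *)
Lemma ProbVE a : (ProbV V a)%:E = P (ev a).
Proof.
pose cell U : set T := [set w | restrict (fun j => V j w) (symbols a) = U].
have cellE U : (U `<=` symbols a)%fset ->
    cell U = \bigcap_(j in [set` symbols a]) (V j @^-1` [set (j \in U)]).
  move=> Ua; apply/seteqP.
  by split=> w /(restrict_eqP _ Ua).
(* Viewing a cell as the event of a formula gives its measurability through [measurable_ev]. *)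
have cell_phi U : (U `<=` symbols a)%fset -> cell U = ev (phiAU (symbols a) U).
  move=> Ua; apply/seteqP; split=> w; rewrite /ev /= csat_phiAU //.
    by move=> /eqP.
  by move/eqP.
have fmodels_sub U : fmodels a U -> (U `<=` symbols a)%fset.
  by move=> [v _ ->]; exact: restrict_sub.
have -> : ev a = \bigcup_(U in fmodels a) cell U.
  apply/seteqP; split=> [w|w [U aU wU]].
    by move=> /fmodels_restrict aw; exists (restrict (fun j => V j w) (symbols a)).
  by apply/fmodels_restrict; rewrite wU.
rewrite measure_fin_bigcup; first last.
- by move=> U /fmodels_sub/cell_phi ->; exact: measurable_ev.
- by move=> U U' _ _ [w [<- <-]].
- exact: finite_fmodels.
rewrite /ProbV -fsumEFin; last exact: finite_fmodels.
apply: eq_fsbigr => U; rewrite inE => /fmodels_sub Ua.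
rewrite /ProbVA -cellE // fineK // fin_num_measure // cell_phi //.
exact: measurable_ev.
Qed.

Lemma ProbV_ge0 a : 0 <= ProbV V a.
Proof. by rewrite -lee_fin ProbVE. Qed.

Lemma ProbV_le1 a : ProbV V a <= 1.
Proof. by rewrite -lee_fin ProbVE probability_le1//; exact: measurable_ev. Qed.

Lemma ProbV_FTrue : ProbV V FTrue = 1.
Proof.
apply/EFin_inj; rewrite ProbVE -(@probability_setT _ _ _ P).
by congr (P _); apply/seteqP; split=> w // _; exact: csat_FTrue.
Qed.

(** The equation between natural numbers says at once that [b] and [c] exclude each other and that
    [a] is their disjunction, so [ev a] is a disjoint union. *)
Lemma ProbVD a b c : (forall v, csat v a = csat v b + csat v c :> nat)%N ->
  ProbV V a = ProbV V b + ProbV V c.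
Proof.
move=> abc; apply/EFin_inj; rewrite EFinD !ProbVE -measureU.
- congr (P _); apply/seteqP; split=> w; rewrite /ev /=; have := abc (V ^~ w).
    by case: csat; case: csat; case: csat => //= _ _; [left|right].
  by case: csat; case: csat; case: csat => //= _ [].
- exact: measurable_ev.
- exact: measurable_ev.
- apply/seteqP; split=> w //; rewrite /ev /= => -[].
  by have := abc (V ^~ w); case: csat; case: csat; case: csat.
Qed.

(* The hypothesis says that the members of [s] are mutually exclusive and that
   their disjunction is equivalent to [a]. *)
Lemma ProbV_sum a s : (forall v, csat v a = count (csat v) s :> nat) ->
  ProbV V a = \sum_(b <- s) ProbV V b.
Proof.
elim: s a => [|b s IHs] a aE.
  (* Here [a] is unsatisfiable, hence the disjoint sum of itself with itself; its probability p
     satisfies p + p = p. *)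
  rewrite big_nil; have /addrI : ProbV V a + ProbV V a = ProbV V a + 0.
    by rewrite addr0 -(@ProbVD a a a) // => v; rewrite aE.
  by apply.
(* Once [b] is split off, the remaining formulas partition [a] without [b]. *)
rewrite big_cons -(IHs (FAnd a (FNot b))).
  apply: ProbVD => v; rewrite csat_FAnd /=; have := aE v.
  by rewrite /=; case: (csat v a); case: (csat v b).
move=> v; rewrite csat_FAnd /=; have := aE v => /=.
by case: (csat v a); case: (csat v b) => //= -[].
Qed.

End Events.

(** * Counting satisfied formulas, to feed [ProbV_sum] *)

Lemma csat_count_phiAU v A :
  count (csat v) [seq phiAU A U | U <- enum_fset (fpowerset A)] = 1%N.
Proof.
(* Among the subsets of [A], only the restriction of [v] gives a formula true at [v]. *)
rewrite count_map (@eq_in_count _ _ (pred1 (restrict v A))).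
  rewrite count_uniq_mem ?fset_uniq //.
  by have -> : restrict v A \in enum_fset (fpowerset A)
    by rewrite -[_ \in _]/(_ \in fpowerset A) fpowersetE restrict_sub.
move=> U; rewrite -[_ \in _]/(_ \in fpowerset A) fpowersetE => UA /=.
by rewrite csat_phiAU // eq_sym.
Qed.

(** Exclusivity is required by position, as in [adequate]: two true entries, even equal ones, would
    contradict it. *)
Lemma count_exclusive v s :
  (forall l l', (l < size s)%N -> (l' < size s)%N -> l <> l' ->
     tautology (FNot (FAnd (nth FTrue s l) (nth FTrue s l')))) ->
  count (csat v) s = has (csat v) s :> nat.
Proof.
elim: s => //= a s IHs excl; rewrite IHs; last first.
  by move=> l l' ls l's ll'; apply: (excl l.+1 l'.+1) => // -[].
case va: (csat v a) => //=; case: (boolP (has _ _)) => // /(has_nthP FTrue)[l ls vl].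
have := excl 0 l.+1 isT ls (@O_S l) v.
by rewrite [csat _ _]/= va vl.
Qed.

(** * Satisfaction of RCOF formulas in the reals *)

Section Arithmetic.
Context (R : realType).
Implicit Types (rho : var -> R) (f g : rform).

Lemma rsat_RAnd rho f g : rsat rho (RAnd f g) <-> rsat rho f /\ rsat rho g.
Proof.
rewrite /RAnd /=; split=> [nfg|[rf rg]]; last by move/(_ rf).
by split; apply: contrapT => H; apply: nfg => // ?.
Qed.

Lemma rsat_RLe rho t u : rsat rho (RLe t u) <-> eval rho t <= eval rho u.
Proof.
rewrite /RLe /= le_eqVlt; split=> [tu|/orP[/eqP|]//].
by case: eqVneq => // /eqP/tu.
Qed.

Lemma rsat_RbigAnd rho s :
  (forall f, List.In f s -> rsat rho f) -> rsat rho (RbigAnd s).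
Proof.
elim: s => //= f s IHs sP; apply/rsat_RAnd.
by split; [apply: sP; left|apply: IHs => g gs; apply: sP; right].
Qed.

Lemma eval_TSum rho s : eval rho (TSum s) = \sum_(t <- s) eval rho t.
Proof. by elim: s => [|t s IHs]; rewrite ?big_nil // big_cons /= IHs. Qed.

Lemma rsat_universal_closure f :
  (forall rho, rsat rho (universal_closure f)) -> forall rho, rsat rho f.
Proof.
rewrite /universal_closure; elim: (undup _) => //= x xs IHxs fP; apply: IHxs => rho.
(* Each quantifier is instantiated with the value [rho] already gives, so the update changes
   nothing. *)
have := fP rho (rho x); congr (rsat _ _).
by apply/funext => y; rewrite /update; case: eqP => [->|].
Qed.

Lemma eq_eval rho rho' t : {in term_vars t, rho =1 rho'} ->
  eval rho t = eval rho' t.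
Proof.
elim: t => [x|||t IHt|t IHt u IHu|t IHt u IHu] //= rr'.
- by apply: rr'; rewrite inE.
- by rewrite IHt.
- by rewrite IHt ?IHu // => x xs; apply: rr'; rewrite mem_cat xs ?orbT.
- by rewrite IHt ?IHu // => x xs; apply: rr'; rewrite mem_cat xs ?orbT.
Qed.

End Arithmetic.

(** * Soundness of the axioms for a fixed stochastic valuation and assignment *)

Section Soundness.
Context (R : realType) (d : measure_display) (T : measurableType d).
Context (P : probability T R) (V : nat -> {RV P >-> bool}) (rho : var -> R).

Definition prob_assignment (x : var) : R :=
  match x with XNat _ => rho x | XForm a => ProbV V a end.

Lemma eval_T_RCOF (p : T_RCOF) :
  eval prob_assignment (sval p) = eval rho (sval p).
Proof.
case: p => p /= /hasPn pX; apply: eq_eval => x /pX.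
by case: x.
Qed.

Lemma psat_PImp f g : psat V rho (PImp f g) <-> (psat V rho f -> psat V rho g).
Proof.
rewrite /=; split=> [[nf /nf|]//|fg].
by case: (pselect (psat V rho f)) => [/fg|]; [right|left].
Qed.

(** The consequent hidden in [PNot] claims that verum has probability below 1, which never holds. *)
Lemma psat_PNot f : psat V rho (PNot f) <-> ~ psat V rho f.
Proof. by rewrite psat_PImp /= ProbV_FTrue ltxx; split=> nf /nf. Qed.

Lemma psat_POr f g :
  psat V rho (POr f g) <-> psat V rho f \/ psat V rho g.
Proof.
rewrite psat_PImp psat_PNot; split=> [fg|[]//].
by case: (pselect (psat V rho f)) => [|/fg]; [left|right].
Qed.

Lemma psat_PAnd f g :
  psat V rho (PAnd f g) <-> psat V rho f /\ psat V rho g.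
Proof.
rewrite psat_PNot psat_PImp psat_PNot; split=> [nfg|[pf pg]]; last by move/(_ pf).
by split; apply: contrapT => H; apply: nfg => // ?.
Qed.

Lemma psat_PbigAnd f s g : psat V rho (PbigAnd f s) ->
  List.In g (f :: s) -> psat V rho g.
Proof.
elim: s f => [|h s IHs] f /=; first by move=> pf [<-|].
by move=> /psat_PAnd[pf /IHs ps] [<- //|/ps].
Qed.

Lemma psat_cppl c : psat V rho (cppl c) <-> rsat prob_assignment (crcof c).
Proof.
case: c => [[a q] p]; rewrite /cppl /crcof /=; case: q.
- by rewrite /= eval_T_RCOF.
- by rewrite /= eval_T_RCOF.
- rewrite psat_POr rsat_RLe /= eval_T_RCOF le_eqVlt.
  by split=> [[/eqP ->//|->]|/orP[/eqP|]]; rewrite ?orbT; [|left|right].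
- by rewrite psat_PNot rsat_RLe /= eval_T_RCOF leNgt; split=> /negP.
Qed.

Lemma rsat_Qformula al Lam : adequate al Lam ->
  rsat prob_assignment (Qformula al Lam).
Proof.
move=> [sizeLam _ _ excl equiv]; apply/rsat_RAnd; split; [|apply/rsat_RAnd; split].
- apply: rsat_RbigAnd => f; rewrite -map_comp => /List.in_map_iff[U [<- _]].
  apply/rsat_RAnd; split; apply/rsat_RLe; rewrite /=.
    exact: ProbV_ge0.
  exact: ProbV_le1.
- rewrite [rsat _ _]/= eval_TSum big_map -(ProbV_FTrue V) /=.
  (* The formulas [phiAU] partition verum, which is why their probabilities add up to 1. *)
  rewrite (@ProbV_sum _ _ _ _ _ FTrue
      [seq phiAU (symbolsU al) U | U <- enum_fset (fpowerset (symbolsU al))]).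
    by rewrite big_map.
  by move=> v; rewrite csat_count_phiAU csat_FTrue.
- apply: rsat_RbigAnd => f /List.in_map_iff[[a cs] [<- acs]].
  rewrite [rsat _ _]/= eval_TSum big_map; apply: ProbV_sum => v.
  (* A pair of the zipped list is traced back to a common index, since [adequate] speaks of
     positions. *)
  have [j [jal -> ->]] : exists j, [/\ (j < size al)%N, a = nth FTrue al j
                                    & cs = nth [::] Lam j].
    elim: (al) (Lam) sizeLam acs => [|a' al' IH] [|cs' Lam'] //= [sz] [[-> ->]|].
      by exists 0%N.
    by move=> /(IH _ sz)[j [? ? ?]]; exists j.+1.
  rewrite count_exclusive; last by move=> l l'; exact: excl.
  have := equiv j jal v; rewrite csat_FAnd -csat_FbigOr /=.
  by case: csat; case: csat.
Qed.

Lemma RR_sound f : RR_axiom R f -> psat V rho f.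
Proof.
move=> [prem [concl [Lam [-> adq [_ /rsat_universal_closure/(_ prob_assignment)]]]]].
(* Stated premise by premise, this covers both shapes of [RR_formula], with and without premises. *)
move=> imp; have {imp} sound :
    (forall c, List.In c prem -> psat V rho (cppl c)) -> psat V rho (cppl concl).
  move=> premP; apply/psat_cppl; refine (imp _).
  apply/(rsat_RAnd prob_assignment (Qformula _ _) (RbigAnd _)).
  split; first exact: rsat_Qformula.
  by apply: rsat_RbigAnd => _ /List.in_map_iff[c [<- /premP/psat_cppl]].
case: prem {adq} sound => [|c s] sound; first exact: sound.
apply/psat_PImp => premP; apply: sound => c' c's.
by apply: (psat_PbigAnd premP); exact: (List.in_map cppl (c :: s)).
Qed.

Lemma TT_sound f : TT_axiom f -> psat V rho f.
Proof.
move=> [a [s [taut ->]]].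
(* The instance behaves like [a] under the classical valuation that makes symbol [j] true exactly
   when [s j] is satisfied. *)
suff: psat V rho (ppl_instance s a) <-> csat (fun j => `[< psat V rho (s j) >]) a.
  by move=> ->; exact: taut.
elim: a {taut} => [j|b IHb|b IHb c IHc]; rewrite [ppl_instance _ _]/=.
- by split=> /asboolP.
- by rewrite psat_PNot IHb; split=> /negP.
- by rewrite psat_PImp IHb IHc; split=> /implyP.
Qed.

End Soundness.

Theorem theorem5p1 (R : realType) (Gamma : set ppl) (phi : ppl) :
  derives R Gamma phi -> entails R Gamma phi.
Proof.
move=> der d T P V rho GammaP; elim: der => [f /GammaP//|f|f|f g _ IHf _].
- exact: TT_sound.
- exact: RR_sound.
- by move=> /psat_PImp; exact.
Qed.
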